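(* Let $\phi\neq1$. Suppose that $\eta^2(\nu)$ is quadratic in $\nu$, that $m_1(\nu)$ and $\eta(\nu)m_2(\nu)$ are linear in $\nu$, and that $m_2^2(\nu)$ is a constant. Suppose $h(t,\nu)$ is conjectured in the exponential-polynomial form such that $$\omega(t,x,\nu)=\frac{x^{1-\gamma}}{1-\gamma}h(t,\nu)^{-\frac{1-\gamma}{1-\phi}}=\frac{x^{1-\gamma}}{1-\gamma}\exp\left\{-\frac{1-\gamma}{1-\phi}\left(A_0(T-t)+\sum_{k=1}^n\frac1kA_k(T-t)\nu^k\right)\right\},$$ where $A_k(\tau)$, $k=0,\dots,n$, are functions of $\tau$ with $A_0(0)=(\phi-1)\ln\varepsilon$ and $A_k(0)=0$ for $k=1,\dots,n$. Then the PDE $$-\frac{h_t}{(1-\phi)h}+r-\zeta_3-\zeta_4(\phi\ln\beta-\ln h)+\frac{1}{2\gamma}\eta^2(\nu)+\frac{\beta\phi}{\phi-1}\left(\beta^{-1}\big(\zeta_3+\zeta_4(\phi\ln\beta-\ln h)\big)-1\right)-\frac{1}{1-\phi}\left[m_1(\nu)+\frac{\eta(\nu)}{\gamma}\rho m_2(\nu)(1-\gamma)\right]\frac{h_\nu}{h}+\frac{1}{2(1-\phi)^2}m_2^2(\nu)\left[2-\phi-\gamma+\frac{\rho^2(1-\gamma)^2}{\gamma}\right]\frac{h_\nu^2}{h^2}-\frac{1}{2(1-\phi)}m_2^2(\nu)\frac{h_{\nu\nu}}{h}=0$$ has no analytical solutions (of this form) when the order $n$ of the polynomial is higher than $2$;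 that is to say, the PDE $$-\frac{h_t}{(1-\phi)h}+r-\beta^\phi h^{-1}+\frac{1}{2\gamma}\eta^2(\nu)+\frac{\beta\phi}{\phi-1}\left(\beta^{\phi-1}h^{-1}-1\right)-\frac{1}{1-\phi}\left[m_1(\nu)+\frac{\eta(\nu)}{\gamma}\rho m_2(\nu)(1-\gamma)\right]\frac{h_\nu}{h}+\frac{1}{2(1-\phi)^2}m_2^2(\nu)\left[2-\phi-\gamma+\frac{\rho^2(1-\gamma)^2}{\gamma}\right]\frac{h_\nu^2}{h^2}-\frac{1}{2(1-\phi)}m_2^2(\nu)\frac{h_{\nu\nu}}{h}=0$$ has no approximate solutions (of this form) under the log-linear approximation method when $n>2$.
   Context: Parameters: $T>0$, $r>0$, $\beta>0$, $\varepsilon>0$, $\gamma>0$ with $\gamma\neq1$, $\phi>0$ with $\phi\ne1$ (elasticity of intertemporal substitution), $\rho\in[-1,1]$; $\eta,m_1,m_2$ are real functions of the state variable $\nu$, where $d\nu_t=m_1(\nu_t)dt+m_2(\nu_t)dW^\nu_t$, $m_2$ is the volatility of the state variable and $\eta(\nu_t)$ is the market price of risk. ''Linear in $\nu$'' means a first-order polynomial $a+b\nu$. Equations are to hold for $t\in[0,T]$ and identically in $\nu$ on the state space. The second displayed PDE arises from the finite-horizon consumption–investment problem with Epstein–Zin recursive utility, $\phi\neq1$, and bequest utility $U(x)=\varepsilon^{1-\gamma}\frac{x^{1-\gamma}}{1-\gamma}$, via the ansatz $\omega(t,x,\nu)=\frac{x^{1-\gamma}}{1-\gamma}h(t,\nu)^{-\frac{1-\gamma}{1-\phi}}$;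 the corresponding optimal consumption is $c^*_t=\beta^\phi h^{-1}x$, where $x$ is wealth. Log-linear approximation method (finite horizon): let $\widetilde v$ be the long-run mean of the state variable. The term $\beta^\phi h^{-1}=c^*_t/x$ is replaced by its first-order expansion around $(\ln c^*_t-\ln x)|_{\nu_t=\widetilde v}$, $$\beta^\phi h^{-1}\approx\zeta_3+\zeta_4(\ln c^*_t-\ln x)=\zeta_3+\zeta_4(\phi\ln\beta-\ln h),$$ where $\zeta_3=\exp\{(\ln c^*_t-\ln x)|_{\nu_t=\widetilde v}\}\left[1-(\ln c^*_t-\ln x)|_{\nu_t=\widetilde v}\right]$ and $\zeta_4=\exp\{(\ln c^*_t-\ln x)|_{\nu_t=\widetilde v}\}$ depend on time but not on $\nu$. The first displayed PDE is the second one after this replacement, and an approximate solution of the second PDE under the log-linear approximation method means a solution of the first PDE. The polynomial $A_0+\sum_{k=1}^n\frac1kA_k\nu^k$ has order $n$ when the function $A_n$ is not identically zero. An ''analytical solution'' means a function $h$ of the stated exponential-polynomial form satisfying the PDE. *)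

(* Defs.v *)
From HB Require Import structures.
From mathcomp Require Import all_boot all_order all_algebra.
From mathcomp Require Import all_classical all_reals all_analysis.
Set Implicit Arguments.
Unset Strict Implicit.
Unset Printing Implicit Defensive.
Import Order.TTheory GRing.Theory Num.Theory.
Import numFieldNormedType.Exports.
Local Open Scope classical_set_scope.
Local Open Scope ring_scope.

(* [state] is the state space of nu; [vbar] is the long-run mean of nu. *)
Record model (R : realType) := Model {
  horizon : R; rate : R; beta : R; eps : R; gamma : R; phi : R; rho : R;
  eta : R -> R; m1 : R -> R; m2 : R -> R;
  state : set R; vbar : R }.

(* The derivative of [f] at [x] relative to [D] is [l]: two-sided at interior
   points of [D], one-sided at the end points of an interval. *)
Definition is_derive_within (R : realType) (D : set R) (f : R -> R) (x l : R) :=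
  (f y - f x) / (y - x) @[y --> within D x^'] --> l.

Definition linear_on (R : realType) (D : set R) (f : R -> R) :=
  exists a b : R, forall nu, D nu -> f nu = a + b * nu.

Definition quadratic_on (R : realType) (D : set R) (f : R -> R) :=
  exists a b c : R, forall nu, D nu -> f nu = a + b * nu + c * nu ^+ 2.

Definition constant_on (R : realType) (D : set R) (f : R -> R) :=
  exists c : R, forall nu, D nu -> f nu = c.

Section Model.
Context (R : realType) (M : model R).

Local Notation T := (horizon M).
Local Notation r := (rate M).
Local Notation beta := (beta M).
Local Notation eps := (eps M).
Local Notation gamma := (gamma M).
Local Notation phi := (phi M).
Local Notation rho := (rho M).
Local Notation eta := (eta M).
Local Notation m1 := (m1 M).
Local Notation m2 := (m2 M).
Local Notation S := (state M).
Local Notation vbar := (vbar M).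

Definition omega (h : R -> R -> R) (t x nu : R) : R :=
  x `^ (1 - gamma) / (1 - gamma) * h t nu `^ (- ((1 - gamma) / (1 - phi))).

Definition exp_poly (n : nat) (A : nat -> R -> R) (t nu : R) : R :=
  A 0%N (T - t) + \sum_(1 <= k < n.+1) k%:R^-1 * A k (T - t) * nu ^+ k.

(* [h] has to be positive for its real powers and logarithm to make sense. *)
Definition conjectured_form (n : nat) (A : nat -> R -> R) (h : R -> R -> R) :=
  [/\ forall t nu : R, t \in `[0, T] -> S nu -> 0 < h t nu,
      forall t x nu : R, t \in `[0, T] -> 0 < x -> S nu ->
        omega h t x nu =
        x `^ (1 - gamma) / (1 - gamma) *
          expR (- ((1 - gamma) / (1 - phi)) * exp_poly n A t nu),
      A 0%N 0 = (phi - 1) * ln eps &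
      forall k, (1 <= k <= n)%N -> A k 0 = 0].

Definition has_order (n : nat) (A : nat -> R -> R) :=
  exists2 tau : R, tau \in `[0, T] & A n tau != 0.

Definition c_star (h : R -> R -> R) (t x nu : R) : R :=
  beta `^ phi * (h t nu)^-1 * x.

(* This is ln c* - ln x, which does not depend on the wealth x: see
   [log_cwE]. *)
Definition log_cw (h : R -> R -> R) (t nu : R) : R := phi * ln beta - ln (h t nu).

Lemma log_cwE (h : R -> R -> R) (t x nu : R) :
  0 < beta -> 0 < h t nu -> 0 < x ->
  ln (c_star h t x nu) - ln x = log_cw h t nu.
Proof.
move=> b0 h0 x0; have bp : 0 < beta `^ phi by rewrite powR_gt0.
rewrite /c_star lnM ?posrE ?mulr_gt0 ?invr_gt0 //.
by rewrite lnM ?posrE ?invr_gt0 // lnV ?posrE // ln_powR addrK.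
Qed.

Definition zeta3 (h : R -> R -> R) (t : R) : R :=
  expR (log_cw h t vbar) * (1 - log_cw h t vbar).

Definition zeta4 (h : R -> R -> R) (t : R) : R := expR (log_cw h t vbar).

(* In the left-hand sides below, [ht], [hv] and [hvv] stand for the partial
   derivatives of [h]. *)
Definition exact_pde (h ht hv hvv : R -> R -> R) (t nu : R) : R :=
  - (ht t nu / ((1 - phi) * h t nu)) + r
  - beta `^ phi * (h t nu)^-1
  + 1 / (2 * gamma) * eta nu ^+ 2
  + beta * phi / (phi - 1) * (beta `^ (phi - 1) * (h t nu)^-1 - 1)
  - 1 / (1 - phi) * (m1 nu + eta nu / gamma * rho * m2 nu * (1 - gamma))
      * (hv t nu / h t nu)
  + 1 / (2 * (1 - phi) ^+ 2) * m2 nu ^+ 2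
      * (2 - phi - gamma + rho ^+ 2 * (1 - gamma) ^+ 2 / gamma)
      * (hv t nu ^+ 2 / h t nu ^+ 2)
  - 1 / (2 * (1 - phi)) * m2 nu ^+ 2 * (hvv t nu / h t nu).

Definition loglinear_pde (h ht hv hvv : R -> R -> R) (t nu : R) : R :=
  - (ht t nu / ((1 - phi) * h t nu)) + r
  - zeta3 h t - zeta4 h t * (phi * ln beta - ln (h t nu))
  + 1 / (2 * gamma) * eta nu ^+ 2
  + beta * phi / (phi - 1)
      * (beta^-1 * (zeta3 h t + zeta4 h t * (phi * ln beta - ln (h t nu))) - 1)
  - 1 / (1 - phi) * (m1 nu + eta nu / gamma * rho * m2 nu * (1 - gamma))
      * (hv t nu / h t nu)
  + 1 / (2 * (1 - phi) ^+ 2) * m2 nu ^+ 2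
      * (2 - phi - gamma + rho ^+ 2 * (1 - gamma) ^+ 2 / gamma)
      * (hv t nu ^+ 2 / h t nu ^+ 2)
  - 1 / (2 * (1 - phi)) * m2 nu ^+ 2 * (hvv t nu / h t nu).

(* The exact PDE with its consumption-wealth ratio beta^phi / h replaced by
   [q t nu]; [exact_pdeE] recovers the exact PDE. *)
Definition pde_with_ratio (q : R -> R -> R) (h ht hv hvv : R -> R -> R)
    (t nu : R) : R :=
  - (ht t nu / ((1 - phi) * h t nu)) + r
  - q t nu
  + 1 / (2 * gamma) * eta nu ^+ 2
  + beta * phi / (phi - 1) * (beta^-1 * q t nu - 1)
  - 1 / (1 - phi) * (m1 nu + eta nu / gamma * rho * m2 nu * (1 - gamma))
      * (hv t nu / h t nu)
  + 1 / (2 * (1 - phi) ^+ 2) * m2 nu ^+ 2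
      * (2 - phi - gamma + rho ^+ 2 * (1 - gamma) ^+ 2 / gamma)
      * (hv t nu ^+ 2 / h t nu ^+ 2)
  - 1 / (2 * (1 - phi)) * m2 nu ^+ 2 * (hvv t nu / h t nu).

Definition exact_ratio (h : R -> R -> R) (t nu : R) : R :=
  beta `^ phi * (h t nu)^-1.

Definition loglinear_ratio (h : R -> R -> R) (t nu : R) : R :=
  zeta3 h t + zeta4 h t * log_cw h t nu.

Lemma exact_pdeE (h ht hv hvv : R -> R -> R) (t nu : R) : 0 < beta ->
  exact_pde h ht hv hvv t nu =
  pde_with_ratio (exact_ratio h) h ht hv hvv t nu.
Proof.
move=> b0; rewrite /exact_pde /pde_with_ratio /exact_ratio.
have -> : beta `^ (phi - 1) = beta^-1 * beta `^ phi.
  rewrite powRB; last by rewrite (gt_eqF b0) implybT.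
  by rewrite powRr1 ?(ltW b0) // mulrC.
by rewrite (mulrA beta^-1).
Qed.

Definition is_solution
    (lhs : forall h ht hv hvv : R -> R -> R, R -> R -> R) (h : R -> R -> R) :=
  exists ht hv hvv : R -> R -> R, forall t nu : R, t \in `[0, T] -> S nu ->
    [/\ is_derive_within `[0, T] (h ^~ nu) t (ht t nu),
        is_derive_within S (h t) nu (hv t nu),
        is_derive_within S (hv t) nu (hvv t nu) &
        lhs h ht hv hvv t nu = 0].

Definition is_loglinear_approx_solution (h : R -> R -> R) :=
  is_solution (pde_with_ratio (loglinear_ratio h)) h.

End Model.

(* Main.v *)
Require Import Defs.
From mathcomp Require Import all_boot all_order all_algebra.
From mathcomp Require Import all_classical all_reals all_analysis.
From mathcomp Require Import ring lra.
Import Order.TTheory GRing.Theory Num.Theory.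
Import numFieldNormedType.Exports.
Local Open Scope classical_set_scope.
Local Open Scope ring_scope.
Set Implicit Arguments.
Unset Strict Implicit.
Unset Printing Implicit Defensive.

(** Since gamma and phi differ from 1, the conjectured form says that, at each
    time t, ln h is a polynomial P_t in nu of degree at most n, with leading
    coefficient A_n(T - t) / n (conjectured_form_ln).
    Dividing the log-linear PDE by h then makes it a Riccati equation
    (log_derivative_poly): the time derivative of P_t at nu is Q_t(nu), where
    Q_t combines the constants, P_t, eta^2, the drift times P_t', P_t'^2 and
    P_t''. Let c be the constant value of m2^2.

    If c <> 0, the coefficient kappa of P_t'^2 is not zero: it is a nonzero
    multiple of gamma + rho^2 (1 - gamma) = gamma (1 - rho^2) + rho^2 > 0. Since
    n > 2, the degree 2n - 2 exceeds n, so P_t'^2 is the only term of the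
    equation that reaches this degree; in particular the time derivative of P_t
    does not. The coefficient of P_t'^2 there is A_n^2, hence A_n = 0.

    If c = 0, the equation is affine in P_t; as n > 2, the quadratic eta^2 does
    not reach degree n, and A_n solves a homogeneous linear ODE with bounded
    coefficient. As A_n(0) = 0, A_n vanishes identically (backward_gronwall0).

    Either way the order n is not attained (top_coef_zero).

    No regularity of the functions A_k is assumed, only that h has derivatives.
    So coefficients are compared through values: the coefficient of order m of
    a polynomial of degree at most m is a fixed linear combination of its
    values at m + 1 points of the interior of the state space
    (coef_as_value_comb). Applied to ln h this combination is differentiable
    in time, and its derivative is the same combination of the values of
    Q_t. *)

(** * Coefficients of a polynomial from its values *)

(** The weights are the last column of the inverse Vandermonde matrix. *)
Lemma coef_as_value_comb (F : fieldType) (m : nat) (x : 'I_m.+1 -> F) :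
  injective x ->
  exists w : 'I_m.+1 -> F, forall p : {poly F}, (size p <= m.+1)%N ->
    \sum_i w i * p.[x i] = p`_m.
Proof.
move=> x_inj.
pose V := Vandermonde m.+1 (\row_i x i).
have Vunit : V \in unitmx.
  rewrite unitmxE unitfE det_Vandermonde.
  apply/prodf_neq0 => i _; apply/prodf_neq0 => j ij.
  rewrite !mxE subr_eq0; apply/eqP => /x_inj ji.
  by rewrite ji ltnn in ij.
pose w := invmx V *m delta_mx ord_max (0 : 'I_1).
have Vw (k : 'I_m.+1) : \sum_i x i ^+ val k * w i 0 = (k == ord_max)%:R.
  have : (V *m w) k 0 = (k == ord_max)%:R.
    by rewrite mulKVmx // mxE eqxx andbT.
  by move=> <-; rewrite [RHS]mxE; apply: eq_bigr => i _; rewrite !mxE.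
exists (fun i => w i 0) => p sp.
under eq_bigr do rewrite (horner_coef_wide _ sp) mulr_sumr.
rewrite exchange_big /=.
have -> : \sum_(k < m.+1) \sum_(i < m.+1) w i 0 * (p`_k * x i ^+ k)
    = \sum_(k < m.+1) p`_k * (k == ord_max)%:R.
  apply: eq_bigr => k _; rewrite -Vw mulr_sumr.
  by apply: eq_bigr => i _; rewrite mulrCA [w i 0 * _]mulrC.
rewrite (bigD1 ord_max) //= eqxx mulr1 big1 ?addr0 // => k /negbTE ->.
by rewrite mulr0.
Qed.

Lemma interior_points (R : realType) (S : set R) (m : nat) : S° !=set0 ->
  exists2 x : 'I_m -> R, injective x & forall i, S° (x i).
Proof.
case=> nu0 Snu0.
have /nbhs_ballP[e /= e0 be] : nbhs nu0 S°.
  by apply: open_nbhs_nbhs; split => //; exact: open_interior.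
(* The shift by 2 makes every denominator exceed 1, as the ball is open. *)
exists (fun i : 'I_m => nu0 + e / (val i).+2%:R) => [i j|i].
  move=> /addrI /(mulfI (lt0r_neq0 e0)) /invr_inj /eqP.
  by rewrite eqr_nat !eqSS => /eqP /val_inj.
apply: be; rewrite /ball /= opprD addNKr normrN gtr0_norm ?divr_gt0 //.
by rewrite ltr_pdivrMr ?ltr0n // ltr_pMr // ltr1n.
Qed.

(** * One-variable calculus *)

Lemma is_derive_within_interior (R : realType) (D : set R) (f : R -> R) x l :
  D° x -> is_derive_within D f x l -> is_derive x (1 : R) f l.
Proof.
rewrite /is_derive_within /within /= => Dx fl.
have {}fl : (f y - f x) / (y - x) @[y --> x^'] --> l.
  apply: cvg_trans fl; move=> A /= fA; rewrite !near_simpl in fA *.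
  near=> y; have /(_ _) : D y -> A ((f y - f x) / (y - x)) by near: y.
  by apply; near: y; apply: nbhs_dnbhs.
apply/is_derive1_caratheodory.
exists (fun y => if y == x then l else (f y - f x) / (y - x)); split.
- move=> y; case: eqP => [->|/eqP]; first by rewrite !subrr mulr0.
  by rewrite -subr_eq0 => /divfK ->.
- apply/continuous_withinNx; rewrite eqxx.
  apply: cvg_trans fl; apply: near_eq_cvg; near=> y.
  have yx : y != x by near: y; exact: nbhs_dnbhs_neq.
  by rewrite (negbTE yx).
- by rewrite eqxx.
Unshelve. all: by end_near. Qed.

Lemma is_derive_within_cvg (R : realType) (D : set R) (f : R -> R) x l :
  is_derive_within D f x l -> f y @[y --> within D (nbhs x)] --> f x.
Proof.
move=> fl.
have flx : f x + (f y - f x) / (y - x) * (y - x) @[y --> within D x^'] --> f x.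
  rewrite -[X in _ --> X]addr0 -[X in _ --> _ + X](mulr0 l).
  apply: cvgD; first exact: cvg_cst.
  apply: cvgM; first exact: fl.
  rewrite -(subrr x); apply: cvgB; last exact: cvg_cst.
  apply: (@cvg_trans _ (nbhs x^')); first exact: cvg_within.
  exact: cvg_within.
move=> A /= fA; rewrite /within /= near_simpl dnbhsE; split; last first.
  rewrite principal_filterP => _; exact: nbhs_singleton fA.
have := flx A fA; rewrite /within /= !near_simpl => fA'.
near=> y => Dy; have : A (f x + (f y - f x) / (y - x) * (y - x)).
  by move: Dy; near: y.
rewrite divfK ?subrKC // subr_eq0; near: y; exact: nbhs_dnbhs_neq.
Unshelve. all: by end_near. Qed.

(** Multiplying by the integrating factor turns the differential inequality
    into monotonicity of the square: its value at the right end is zero, and it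
    cannot decrease on the way there. *)
Lemma backward_gronwall0 (R : realType) (T K : R) (f f' : R -> R) :
  {within `[0, T], continuous f} -> f T = 0 ->
  (forall t, t \in `]0, T[ -> is_derive t (1 : R) f (f' t)) ->
  (forall t, t \in `]0, T[ -> `|f' t| <= K * `|f t|) ->
  forall t, t \in `[0, T] -> f t = 0.
Proof.
move=> fc fT0 df bf t tT.
pose F s := f s * f s * expR (2 * K * s).
have dE s : is_derive s (1 : R) (fun s => expR (2 * K * s))
    (expR (2 * K * s) * (2 * K)).
  have dl : is_derive s (1 : R) (fun s => 2 * K * s) (2 * K).
    by apply: is_derive_eq; rewrite /GRing.scale /= mulr1.
  exact: is_derive1_comp.
have dF s : s \in `]0, T[ ->
    is_derive s (1 : R) F (2 * (f s * f' s + K * f s ^+ 2) * expR (2 * K * s)).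
  move=> sT; have ds := df s sT.
  apply: is_derive_eq; rewrite /GRing.scale /=.
  by move: (f s) (f' s) (expR _) => u v e; ring.
have Fc : {within `[0, T], continuous F}.
  move=> s; apply: cvgM; first by apply: cvgM; exact: fc.
  apply: continuous_subspaceT => {}s.
  by apply/differentiable_continuous/derivable1_diffP; case: (dE s).
have /andP[t0 tleT] : 0 <= t <= T by move: tT; rewrite in_itv.
have FtT : F t <= F T.
  apply: (@ger0_derive1_le R F 0 T _ _ true false Fc t T tT _ tleT).
  - by move=> s /dF [].
  - move=> s sT; have [_] := dF s sT; rewrite derive1E => ->.
    rewrite mulr_ge0 ?expR_ge0 // mulr_ge0 //.
    have : - (f s * f' s) <= `|f s| * (K * `|f s|).
      rewrite (le_trans (ler_norm _)) // normrN normrM.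
      by rewrite ler_wpM2l // bf.
    by rewrite mulrCA -normrM -expr2 ger0_norm ?sqr_ge0 // => h; lra.
  - by rewrite in_itv /= lexx (le_trans t0).
move: FtT; rewrite /F fT0 mulr0 mul0r pmulr_lle0 ?expR_gt0 // -expr2.
by rewrite le_eqVlt ltNge sqr_ge0 orbF sqrf_eq0 => /eqP.
Qed.

Lemma within_itv_interior (R : realType) (a b t : R) :
  t \in `]a, b[ -> (`[a, b]%classic : set R)° t.
Proof.
move=> tab; rewrite /interior /=.
apply: (@filterS _ (nbhs t) _ `]a, b[%classic).
  by move=> s /=; exact: subset_itv_oo_cc.
by apply: open_nbhs_nbhs; split => //; exact: itv_open.
Qed.

(** * Time derivative of combinations of values of ln h *)

Lemma value_comb_continuous (R : realType) (T : R) (m : nat)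
    (h : R -> R -> R) (ht : R -> R -> R) (x w : 'I_m -> R) :
  (forall t i, t \in `[0, T] -> 0 < h t (x i)) ->
  (forall t i, t \in `[0, T] ->
     is_derive_within `[0, T] (h ^~ (x i)) t (ht t (x i))) ->
  {within `[0, T], continuous (fun t => \sum_i w i * ln (h t (x i)))}.
Proof.
move=> hpos dh; apply/subspace_continuousP => t tT.
apply: cvg_big => [|i _]; first exact: add_continuous.
apply: cvgM; first exact: cvg_cst.
apply: (@cvg_comp _ _ _ (h ^~ (x i)) (@ln R)).
  exact: is_derive_within_cvg (dh t i tT).
exact: continuous_ln (hpos t i tT).
Qed.

Lemma value_comb_is_derive (R : realType) (T : R) (m : nat)
    (h : R -> R -> R) (ht : R -> R -> R) (x w : 'I_m -> R) :
  (forall t i, t \in `[0, T] -> 0 < h t (x i)) ->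
  (forall t i, t \in `[0, T] ->
     is_derive_within `[0, T] (h ^~ (x i)) t (ht t (x i))) ->
  forall t, t \in `]0, T[ ->
    is_derive t (1 : R) (fun t => \sum_i w i * ln (h t (x i)))
      (\sum_i w i * (ht t (x i) / h t (x i))).
Proof.
move=> hpos dh t tT.
have tT' : t \in `[0, T] by exact: subset_itv_oo_cc tT.
have -> : (fun t => \sum_i w i * ln (h t (x i))) =
    \sum_i (fun t => w i * ln (h t (x i))).
  by apply/funext => s; rewrite fct_sumE.
apply: is_derive_sum => i.
have dhi : is_derive t (1 : R) (h ^~ (x i)) (ht t (x i)).
  exact: is_derive_within_interior (within_itv_interior tT) (dh t i tT').
have dl : is_derive (h t (x i)) (1 : R) (@ln R) (h t (x i))^-1.
  exact: is_derive1_ln (hpos t i tT').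
have dc : is_derive t (1 : R) (fun s => ln (h s (x i)))
    ((h t (x i))^-1 * ht t (x i)) by exact: is_derive1_comp.
by apply: is_derive_eq; rewrite /GRing.scale /= [_^-1 * _]mulrC; ring.
Qed.

Lemma is_derive_vanishing (R : realType) (a b : R) (f : R -> R) (t l : R) :
  (forall s, s \in `]a, b[ -> f s = 0) -> t \in `]a, b[ ->
  is_derive t (1 : R) f l -> l = 0.
Proof.
move=> f0 tab df.
have d0 : is_derive t (1 : R) f 0.
  have d0 : is_derive t (1 : R) (fun=> 0 : R) 0 by exact: is_derive_cst.
  apply: near_eq_is_derive d0.
  near=> s; rewrite f0 //; near: s.
  by apply: open_nbhs_nbhs; split => //; exact: itv_open.
by rewrite -(@derive_val _ _ _ _ _ _ _ df) (@derive_val _ _ _ _ _ _ _ d0).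
Unshelve. all: by end_near. Qed.

(** * Space derivatives of the exponential of a polynomial *)

(** Only interior points are considered: there the derivatives relative to [S]
    are ordinary ones, and the formula for [f1] holds on a neighbourhood, which
    is what allows [f1] to be differentiated again. *)
Lemma exp_poly_space_derivatives (R : realType) (S : set R) (p : {poly R})
    (f f1 f2 : R -> R) :
  (forall y, S y -> f y = expR p.[y]) ->
  (forall y, S y -> is_derive_within S f y (f1 y)) ->
  (forall y, S y -> is_derive_within S f1 y (f2 y)) ->
  forall y, S° y -> f1 y = p^`().[y] * f y /\
    f2 y = (p^`()^`().[y] + p^`().[y] ^+ 2) * f y.
Proof.
move=> fE d1 d2.
have dexp y : is_derive y (1 : R) (fun z => expR p.[z]) (expR p.[y] * p^`().[y]).
  by apply: is_derive1_comp.
have f1E y : S° y -> f1 y = p^`().[y] * expR p.[y].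
  move=> Sy; have df := is_derive_within_interior Sy (d1 y (interior_subset Sy)).
  rewrite mulrC; have <- := @derive_val _ _ _ _ _ _ _ (dexp y).
  have <- := @derive_val _ _ _ _ _ _ _ df.
  by apply: near_eq_derive; near=> z; apply: fE; near: z.
move=> y Sy; rewrite fE; last exact: interior_subset.
split; first exact: f1E.
have df1 := is_derive_within_interior Sy (d2 y (interior_subset Sy)).
have dprod : is_derive y (1 : R) (fun z => p^`().[z] * expR p.[z])
    ((p^`()^`().[y] + p^`().[y] ^+ 2) * expR p.[y]).
  have := dexp y => ?; have ? := is_derive_poly p^`() y.
  by apply: is_derive_eq; rewrite /GRing.scale /=; ring.
have <- := @derive_val _ _ _ _ _ _ _ dprod.
have <- := @derive_val _ _ _ _ _ _ _ df1.
apply: near_eq_derive; near=> z; apply: f1E; near: z.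
by apply: open_nbhs_nbhs; split => //; exact: open_interior.
Unshelve. all: by end_near. Qed.

(** * The conjectured form and the equation for ln h *)

(** The constant term of the exponent is [A 0] itself, whereas the summands of
    positive order carry the factor 1/k; the case [k = 0] has to be separated
    because the inverse of 0 is 0. *)
Definition log_poly (R : realType) (n : nat) (A : nat -> R -> R) (tau : R) :=
  \poly_(k < n.+1) ((if k is 0%N then 1 else k%:R^-1) * A k tau).

Lemma horner_log_poly (R : realType) (M : model R) n A t nu :
  (log_poly n A (horizon M - t)).[nu] = exp_poly M n A t nu.
Proof.
rewrite horner_poly big_ord_recl /= mul1r expr0 mulr1 /exp_poly; congr (_ + _).
by rewrite big_add1 /= big_mkord.
Qed.

Lemma conjectured_form_ln (R : realType) (M : model R) n A h :
  gamma M != 1 -> phi M != 1 -> conjectured_form M n A h ->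
  forall t nu, t \in `[0, horizon M] -> state M nu ->
    ln (h t nu) = (log_poly n A (horizon M - t)).[nu].
Proof.
move=> g1 p1 [hpos hform _ _] t nu tT Snu; rewrite horner_log_poly.
have := hform t 1 nu tT ltr01 Snu; rewrite /omega powR1 div1r.
have c0 : 1 - gamma M != 0 by rewrite subr_eq0 eq_sym.
move/(mulfI (invr_neq0 c0)).
rewrite /powR (gt_eqF (hpos t nu tT Snu)) => /expR_inj; apply: mulfI.
by rewrite oppr_eq0 mulf_neq0 // invr_eq0 subr_eq0 eq_sym.
Qed.

(** The coefficient that multiplies (h_nu / h)^2 once the equation is solved for
    h_t / h: it collects the term in h_nu^2 / h^2 and the part of h_nunu / h
    equal to (h_nu / h)^2. *)
Definition kappa (R : realType) (M : model R) (c : R) :=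
  c * (1 - gamma M) * (gamma M + rho M ^+ 2 * (1 - gamma M))
    / (2 * gamma M * (1 - phi M)).

(** The factor gamma + rho^2 (1 - gamma) is gamma (1 - rho^2) + rho^2, which is
    positive because rho^2 is in [0, 1] and gamma > 0. *)
Lemma kappa_neq0 (R : realType) (M : model R) (c : R) :
  0 < gamma M -> gamma M != 1 -> phi M != 1 -> -1 <= rho M <= 1 ->
  c != 0 -> kappa M c != 0.
Proof.
move=> g0 g1 p1 /andP[rho_ge rho_le] c0.
have rho2 : 0 <= rho M ^+ 2 <= 1 by rewrite sqr_ge0 /= expr2; nra.
have pos : 0 < gamma M + rho M ^+ 2 * (1 - gamma M).
  by case/andP: rho2 => r0 r1; nra.
rewrite /kappa !mulf_neq0 ?(lt0r_neq0 pos) ?invr_neq0 //.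
  by rewrite subr_eq0 eq_sym.
by rewrite !mulf_neq0 ?(lt0r_neq0 g0) ?pnatr_eq0 // subr_eq0 eq_sym.
Qed.

(** The part of h_t / h that depends on time only: ln h enters it through its
    value at [vbar] alone. *)
Definition log_source (R : realType) (M : model R) (h : R -> R -> R) (t : R) :=
  (1 - phi M) * rate M + beta M * phi M - zeta3 M h t
    - zeta4 M h t * (phi M * ln (beta M)).

(** In terms of ln h, whose derivatives in nu are [u] and [v], the equation
    becomes polynomial. The consumption ratio enters it with total coefficient
    -1 + phi / (phi - 1) = 1 / (phi - 1), which the factor 1 - phi turns into
    -1. *)
Lemma pde_log_form (R : realType) (M : model R) (h ht hv hvv : R -> R -> R)
    (t nu a c u v : R) :
  0 < beta M -> 0 < gamma M -> phi M != 1 -> 0 < h t nu ->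
  m1 M nu + rho M * (1 - gamma M) / gamma M * (eta M nu * m2 M nu) = a ->
  m2 M nu ^+ 2 = c ->
  hv t nu = u * h t nu -> hvv t nu = (v + u ^+ 2) * h t nu ->
  pde_with_ratio M (loglinear_ratio M h) h ht hv hvv t nu = 0 ->
  ht t nu / h t nu =
    log_source M h t + zeta4 M h t * ln (h t nu)
    + (1 - phi M) / (2 * gamma M) * eta M nu ^+ 2
    - a * u + kappa M c * u ^+ 2 - c / 2 * v.
Proof.
move=> b0 g0 p1 h0 <- <- hvE hvvE.
rewrite /pde_with_ratio /loglinear_ratio /log_cw /log_source /kappa hvE hvvE.
have hn : h t nu != 0 by rewrite gt_eqF.
have bn : beta M != 0 by rewrite gt_eqF.
have gn : gamma M != 0 by rewrite gt_eqF.
have pn : 1 - phi M != 0 by rewrite subr_eq0 eq_sym.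
have pn' : phi M - 1 != 0 by rewrite subr_eq0.
move: (zeta3 _ _ _) (zeta4 _ _ _) (ln _) (ln _) => z3 z4 lb lh E.
apply/eqP; rewrite eq_sym -subr_eq0; apply/eqP.
rewrite -[RHS](mulr0 (1 - phi M)) -E.
by field; rewrite hn bn gn pn pn'.
Qed.

(** * The Riccati right-hand side as a polynomial in the state variable *)

Lemma coefM_top (R : nzRingType) (p q : {poly R}) (a b : nat) :
  (size p <= a.+1)%N -> (size q <= b.+1)%N -> (p * q)`_(a + b) = p`_a * q`_b.
Proof.
move=> sp sq; rewrite coefM.
have lt_a : (a < (a + b).+1)%N by rewrite ltnS leq_addr.
rewrite (bigD1 (Ordinal lt_a)) //= addKn big1 ?addr0 // => i ia.
have [lt_ai|le_ia] := ltnP a i.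
  by rewrite (nth_default 0 (leq_trans sp lt_ai)) mul0r.
have {ia}lt_ia : (i < a)%N by rewrite ltn_neqAle le_ia andbT.
rewrite [q`__]nth_default ?mulr0 //.
by rewrite (leq_trans sq) // ltn_subRL ltn_add2r.
Qed.

Lemma size_polyM_top (R : nzRingType) (p q : {poly R}) (a b : nat) :
  (size p <= a.+1)%N -> (size q <= b.+1)%N -> (size (p * q)%R <= (a + b).+1)%N.
Proof.
move=> sp sq; apply: leq_trans (size_polyMleq _ _) _.
by rewrite -subn1 leq_subLR add1n -addnS -addSn leq_add.
Qed.

Lemma size_deriv_leq (R : nzRingType) (p : {poly R}) (a : nat) :
  (size p <= a.+1)%N -> (size p^`() <= a)%N.
Proof.
by move=> sp; apply: leq_trans (size_poly _ _) _; rewrite -subn1 leq_subLR.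
Qed.

(** The right-hand side of the equation for P = ln h: [E] stands for the
    quadratic eta^2, [B] for the affine coefficient m1 + (eta m2) rho
    (1 - gamma) / gamma of h_nu; [k] and [e] are proportional to m2^2. *)
Definition riccati_poly (R : nzRingType) (s z d k e : R) (E B P : {poly R}) :=
  s%:P + z *: P + d *: E - B * P^`() + k *: (P^`() * P^`()) - e *: P^`()^`().

Section RiccatiPoly.
Variables (R : nzRingType) (N : nat) (s z d k e : R) (E B P : {poly R}).
Hypotheses (N_gt1 : (1 < N)%N) (sE : (size E <= 3)%N) (sB : (size B <= 2)%N)
  (sP : (size P <= N.+2)%N).

Let sP' : (size P^`() <= N.+1)%N := size_deriv_leq sP.
Let sP'' : (size P^`()^`() <= N)%N := size_deriv_leq sP'.

Lemma size_riccati_affine_part (m : nat) : (N < m)%N ->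
  (size (s%:P + z *: P + d *: E - B * P^`())%R <= m.+1)%N.
Proof.
move=> Nm; have N2 : (N.+2 <= m.+1)%N by [].
do ![rewrite (leq_trans (size_polyD _ _)) // geq_max; apply/andP; split].
- by rewrite (leq_trans (size_polyC_leq1 _)).
- by rewrite (leq_trans (size_scale_leq _ _)) // (leq_trans sP).
- rewrite (leq_trans (size_scale_leq _ _)) // (leq_trans sE) //.
  by rewrite ltnS (leq_trans N_gt1) // ltnW.
- by rewrite size_polyN (leq_trans (size_polyM_top sB sP')).
Qed.

Lemma size_riccati_poly : (size (riccati_poly s z d k e E B P) <= (N + N).+1)%N.
Proof.
rewrite (leq_trans (size_polyD _ _)) // geq_max; apply/andP; split.
  rewrite (leq_trans (size_polyD _ _)) // geq_max; apply/andP; split.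
    by rewrite size_riccati_affine_part // -[ltnLHS]addn0 ltn_add2l ltnW.
  by rewrite (leq_trans (size_scale_leq _ _)) ?(size_polyM_top sP' sP').
rewrite size_polyN (leq_trans (size_scale_leq _ _)) //.
by rewrite (leq_trans sP'') // leqW ?leq_addr.
Qed.

(** With P of degree N + 1 and N > 1, all the terms other than the square of P'
    have degree at most N + 1 < 2N. *)
Lemma coef_riccati_poly_top :
  (riccati_poly s z d k e E B P)`_(N + N) = k * (P^`()`_N) ^+ 2.
Proof.
rewrite /riccati_poly coefD coefN coefZ coefD coefZ (coefM_top sP' sP').
rewrite [P^`()^`()`__]nth_default; last by rewrite (leq_trans sP'') ?leq_addr.
rewrite nth_default ?add0r ?mulr0 ?subr0 //.
have NN : (N < (N + N).-1)%N.
  by rewrite -ltnS prednK ?addn_gt0 ?(ltnW N_gt1) // -addn2 leq_add2l.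
rewrite (leq_trans (size_riccati_affine_part NN)) // prednK //.
by rewrite addn_gt0 (ltnW N_gt1).
Qed.
End RiccatiPoly.

Lemma size_riccati_poly_degenerate (R : nzRingType) (N : nat) (s z d : R)
    (E B P : {poly R}) :
  (1 < N)%N -> (size E <= 3)%N -> (size B <= 2)%N -> (size P <= N.+2)%N ->
  (size (riccati_poly s z d 0 0 E B P) <= N.+2)%N.
Proof.
move=> N1 sE sB sP; rewrite /riccati_poly !scale0r subr0 addr0.
by have := size_riccati_affine_part s z d N1 sE sB sP (ltnSn N).
Qed.

(** Without volatility ([k = e = 0]) the square of P' disappears, and the top
    coefficient of P then obeys a homogeneous linear equation, because the
    degree N + 1 > 2 is out of reach for [E]. *)
Lemma coef_riccati_poly_degenerate (R : nzRingType) (N : nat) (s z d : R)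
    (E B P : {poly R}) :
  (1 < N)%N -> (size E <= 3)%N -> (size B <= 2)%N -> (size P <= N.+2)%N ->
  (riccati_poly s z d 0 0 E B P)`_N.+1 = (z - B`_1 * N.+1%:R) * P`_N.+1.
Proof.
move=> N1 sE sB sP; rewrite /riccati_poly !scale0r subr0 addr0.
rewrite coefB -add1n (coefM_top sB (size_deriv_leq sP)) add1n.
rewrite !coefD coefC !coefZ coef_deriv (nth_default _ (leq_trans sE _)) //.
by rewrite mulr0 add0r addr0 mulrBl -mulrA mulr_natl.
Qed.

(** * Vanishing of the leading coefficient *)

Lemma size_affine (R : nzRingType) (a b : R) : (size (a%:P + b *: 'X)%R <= 2)%N.
Proof.
rewrite (leq_trans (size_polyD _ _)) // geq_max.
rewrite (leq_trans (size_polyC_leq1 _)) //=.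
by rewrite (leq_trans (size_scale_leq _ _)) ?size_polyX.
Qed.

Lemma size_quadratic (R : nzRingType) (a b c : R) :
  (size (a%:P + b *: 'X + c *: 'X^2)%R <= 3)%N.
Proof.
rewrite (leq_trans (size_polyD _ _)) // geq_max.
rewrite (leq_trans (size_affine _ _)) //=.
by rewrite (leq_trans (size_scale_leq _ _)) ?size_polyXn.
Qed.

(** [zeta4] depends on the unknown h, but only through h at the single point
    [vbar], where h is positive and continuous in time on a compact interval. *)
Lemma zeta4_bounded (R : realType) (M : model R) (h ht : R -> R -> R) :
  0 < horizon M ->
  (forall t, t \in `[0, horizon M] -> 0 < h t (vbar M)) ->
  (forall t, t \in `[0, horizon M] ->
     is_derive_within `[0, horizon M] (h ^~ (vbar M)) t (ht t (vbar M))) ->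
  exists C, forall t, t \in `[0, horizon M] -> `|zeta4 M h t| <= C.
Proof.
move=> T0 hpos dh.
have zc : {within `[0, horizon M], continuous (zeta4 M h)}.
  apply/subspace_continuousP => t tT; rewrite /zeta4 /log_cw.
  apply: (@cvg_comp _ _ _
    (fun t => phi M * ln (beta M) - ln (h t (vbar M))) expR);
    last exact: continuous_expR.
  apply: cvgB; first exact: cvg_cst.
  apply: (@cvg_comp _ _ _ (h ^~ (vbar M)) (@ln R)).
    exact: is_derive_within_cvg (dh t tT).
  exact: continuous_ln (hpos t tT).
have [c _ cmax] := EVT_max (ltW T0) zc.
exists (zeta4 M h c) => t tT; rewrite ger0_norm ?expR_ge0 //; exact: cmax.
Qed.

(** The polynomials [B], [E] and the constant [c] depend on the model only, so
    that at each time h_t / h is the value of one polynomial in [nu] whose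
    coefficients can be compared. *)
Lemma log_derivative_poly (R : realType) (M : model R) :
  0 < beta M -> 0 < gamma M -> phi M != 1 ->
  quadratic_on (state M) (fun nu => eta M nu ^+ 2) ->
  linear_on (state M) (m1 M) ->
  linear_on (state M) (fun nu => eta M nu * m2 M nu) ->
  constant_on (state M) (fun nu => m2 M nu ^+ 2) ->
  exists (c : R) (B E : {poly R}),
  [/\ (size B <= 2)%N, (size E <= 3)%N &
  forall (h ht hv hvv : R -> R -> R) (P : {poly R}) (t nu : R),
    0 < h t nu -> state M nu -> ln (h t nu) = P.[nu] ->
    hv t nu = P^`().[nu] * h t nu ->
    hvv t nu = (P^`()^`().[nu] + P^`().[nu] ^+ 2) * h t nu ->
    pde_with_ratio M (loglinear_ratio M h) h ht hv hvv t nu = 0 ->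
    ht t nu / h t nu =
      (riccati_poly (log_source M h t) (zeta4 M h t)
         ((1 - phi M) / (2 * gamma M)) (kappa M c) (c / 2) E B P).[nu]].
Proof.
move=> b0 g0 p1 [e0 [e1 [e2 eE]]] [a0 [a1 aE]] [d0 [d1 dE]] [c cE].
pose l := rho M * (1 - gamma M) / gamma M.
exists c, ((a0 + l * d0)%:P + (a1 + l * d1) *: 'X),
  (e0%:P + e1 *: 'X + e2 *: 'X^2);
  split; [exact: size_affine|exact: size_quadratic|].
move=> h ht hv hvv P t nu h0 Snu lnE hvE hvvE pde0.
rewrite (pde_log_form b0 g0 p1 h0 (erefl _) (cE nu Snu) hvE hvvE pde0) /=.
rewrite (eE nu Snu) (aE nu Snu) (dE nu Snu) lnE /riccati_poly !hornerE.
by rewrite -/l; ring.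
Qed.

(** The degree of the polynomial is N + 1 with N > 1. The function [f] below is
    the coefficient of order N + 1 of ln h, written as a combination of values
    so that it is differentiable, and the proof consists in bounding its
    derivative by a multiple of itself. It vanishes at t = T because
    A_n(0) = 0. *)
Lemma top_coef_zero (R : realType) (M : model R) (n : nat)
    (A : nat -> R -> R) (h : R -> R -> R) :
  0 < horizon M -> 0 < beta M -> 0 < gamma M -> gamma M != 1 -> phi M != 1 ->
  -1 <= rho M <= 1 -> (state M)° !=set0 -> state M (vbar M) ->
  quadratic_on (state M) (fun nu => eta M nu ^+ 2) ->
  linear_on (state M) (m1 M) ->
  linear_on (state M) (fun nu => eta M nu * m2 M nu) ->
  constant_on (state M) (fun nu => m2 M nu ^+ 2) ->
  (2 < n)%N -> conjectured_form M n A h -> is_loglinear_approx_solution M h ->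
  forall tau, tau \in `[0, horizon M] -> A n tau = 0.
Proof.
move=> T0 b0 g0 g1 p1 rho_itv Sint Svbar eta2 m1_lin em_lin m2_cst.
case: n => // N N_gt1; rewrite ltnS in N_gt1.
move=> form [ht [hv [hvv sol]]].
have [c [B [E [sB sE riccati]]]] :=
  log_derivative_poly b0 g0 p1 eta2 m1_lin em_lin m2_cst.
set T := horizon M in T0 *.
pose P t := log_poly N.+1 A (T - t).
have sP t : (size (P t) <= N.+2)%N by exact: size_poly.
have lnE := conjectured_form_ln g1 p1 form.
have [hpos _ _ A0] := form.
pose Q t := riccati_poly (log_source M h t) (zeta4 M h t)
  ((1 - phi M) / (2 * gamma M)) (kappa M c) (c / 2) E B (P t).
have htE t nu : t \in `[0, T] -> (state M)° nu -> ht t nu / h t nu = (Q t).[nu].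
  move=> tT Snu; have Snu' := interior_subset Snu.
  have hE y : state M y -> h t y = expR (P t).[y].
    by move=> Sy; rewrite -lnE // lnK // posrE hpos.
  have [] := @exp_poly_space_derivatives _ (state M) (P t) (h t) (hv t) (hvv t)
    hE _ _ nu Snu; [by move=> y /(sol t y tT)[]..|].
  move=> hvE hvvE; apply: (riccati h ht hv hvv) => //.
  - exact: hpos.
  - exact: lnE.
  - by have [] := sol t nu tT Snu'.
have combs m : exists (x w : 'I_m.+1 -> R), (forall i, (state M)° (x i)) /\
    forall p : {poly R}, (size p <= m.+1)%N -> \sum_i w i * p.[x i] = p`_m.
  have [x x_inj Sx] := interior_points m.+1 Sint.
  by have [w wE] := coef_as_value_comb x_inj; exists x, w.
(* The clause on [f'] needs a degree bound on [Q t]. In the presence of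
   volatility it holds for m = 2N, but not a priori for m = N + 1, since the
   square of P' has degree 2N unless the leading coefficient of P vanishes. *)
have coef m : (N < m)%N -> exists (f f' : R -> R),
    [/\ {within `[0, T], continuous f}, forall t, t \in `[0, T] -> f t = (P t)`_m,
        forall t, t \in `]0, T[ -> is_derive t (1 : R) f (f' t) &
        forall t, t \in `]0, T[ -> (size (Q t) <= m.+1)%N -> f' t = (Q t)`_m].
  move=> Nm; have [x [w [Sx wE]]] := combs m.
  have Sx' i : state M (x i) by exact: interior_subset.
  have hx t i : t \in `[0, T] -> 0 < h t (x i) by move=> tT; exact: hpos.
  have dx t i : t \in `[0, T] ->
      is_derive_within `[0, T] (h ^~ (x i)) t (ht t (x i)).
    by move=> tT; have [] := sol t (x i) tT (Sx' i).
  exists (fun t => \sum_i w i * ln (h t (x i))),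
    (fun t => \sum_i w i * (ht t (x i) / h t (x i))); split.
  - exact: value_comb_continuous dx.
  - move=> t tT; rewrite -wE; last by rewrite (leq_trans (sP t)).
    by apply: eq_bigr => i _; rewrite lnE.
  - exact: value_comb_is_derive.
  - move=> t /subset_itv_oo_cc tT sQ; rewrite -wE //.
    by apply: eq_bigr => i _; rewrite htE.
have PN t : (P t)`_N.+1 = N.+1%:R^-1 * A N.+1 (T - t).
  by rewrite coef_poly ltnSn.
have [f [f' [fc fE df f'E]]] := coef _ (ltnSn N).
have fT : f T = 0.
  have TT : T \in `[0, T] by rewrite in_itv /= lexx (ltW T0).
  by rewrite fE // PN subrr A0 ?leqnn // mulr0.
suff [K bK] : exists K, forall t, t \in `]0, T[ -> `|f' t| <= K * `|f t|.
  move=> tau tauT; have tT : T - tau \in `[0, T].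
    by move: tauT; rewrite !in_itv /= => /andP[t0 t1]; apply/andP; split; lra.
  have := backward_gronwall0 fc fT df bK tT; rewrite fE // PN subKr => /eqP.
  by rewrite mulf_eq0 invr_eq0 pnatr_eq0 => /eqP.
have [c0|c_neq0] := eqVneq c 0.
  have hv0 t : t \in `[0, T] -> 0 < h t (vbar M) by move=> tT; exact: hpos.
  have dv t : t \in `[0, T] ->
      is_derive_within `[0, T] (h ^~ (vbar M)) t (ht t (vbar M)).
    by move=> tT; have [] := sol t (vbar M) tT Svbar.
  have [C zC] := zeta4_bounded T0 hv0 dv.
  exists (C + `|B`_1 * N.+1%:R|) => t tT.
  have tT' : t \in `[0, T] by exact: subset_itv_oo_cc tT.
  have QE : Q t = riccati_poly (log_source M h t) (zeta4 M h t)
      ((1 - phi M) / (2 * gamma M)) 0 0 E B (P t).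
    by rewrite /Q /kappa c0 !mul0r.
  rewrite f'E // QE ?size_riccati_poly_degenerate //.
  rewrite coef_riccati_poly_degenerate // -fE // normrM ler_wpM2r //.
  by rewrite (le_trans (ler_normB _ _)) // lerD2r zC.
have N_lt : (N < N + N)%N by rewrite -[ltnLHS]addn0 ltn_add2l ltnW.
(* With volatility: the coefficient [g] of order 2N of ln h is zero because
   2N > N + 1, so its derivative, kappa times the square of the leading
   coefficient of P', is zero too. This covers the open interval only; the
   continuity of [f] extends it to the end points. *)
have f0_in t : t \in `]0, T[ -> f t = 0.
  move=> tT; have [g [g' [_ gE dg g'E]]] := coef _ N_lt.
  have g0' s : s \in `]0, T[ -> g s = 0.
    move=> /subset_itv_oo_cc sT; rewrite gE // nth_default //.
    by rewrite (leq_trans (sP s)) // -addn2 leq_add2l.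
  have /eqP := is_derive_vanishing g0' tT (dg t tT).
  rewrite g'E ?size_riccati_poly // coef_riccati_poly_top //.
  rewrite mulf_eq0 (negbTE (kappa_neq0 g0 g1 p1 rho_itv c_neq0)) sqrf_eq0.
  rewrite coef_deriv mulrn_eq0 /= => /eqP <-.
  by rewrite fE //; exact: subset_itv_oo_cc.
exists 0 => t tT; rewrite (is_derive_vanishing f0_in tT (df t tT)).
by rewrite mul0r normr0.
Qed.

Lemma loglinear_pdeE (R : realType) (M : model R) (h ht hv hvv : R -> R -> R)
    (t nu : R) :
  loglinear_pde M h ht hv hvv t nu =
  pde_with_ratio M (loglinear_ratio M h) h ht hv hvv t nu.
Proof.
by rewrite /loglinear_pde /pde_with_ratio /loglinear_ratio /log_cw opprD !addrA.
Qed.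

Theorem theorem4p11 (R : realType) (M : model R)
  (T_gt0 : 0 < horizon M) (r_gt0 : 0 < rate M) (beta_gt0 : 0 < beta M)
  (eps_gt0 : 0 < eps M) (gamma_gt0 : 0 < gamma M) (gamma_neq1 : gamma M != 1)
  (phi_gt0 : 0 < phi M) (phi_neq1 : phi M != 1)
  (rho_itv : -1 <= rho M <= 1)
  (state_itv : is_interval (state M)) (state_int : (state M)° !=set0)
  (state_vbar : state M (vbar M))
  (eta2_quadratic : quadratic_on (state M) (fun nu => eta M nu ^+ 2))
  (m1_linear : linear_on (state M) (m1 M))
  (eta_m2_linear : linear_on (state M) (fun nu => eta M nu * m2 M nu))
  (m2_constant : constant_on (state M) (fun nu => m2 M nu ^+ 2))
  (n : nat) (n_gt2 : (2 < n)%N) :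
  (~ exists (A : nat -> R -> R) (h : R -> R -> R),
       [/\ conjectured_form M n A h, has_order M n A &
           is_solution M (loglinear_pde M) h]) /\
  (~ exists (A : nat -> R -> R) (h : R -> R -> R),
       [/\ conjectured_form M n A h, has_order M n A &
           is_loglinear_approx_solution M h]).
Proof.
have no_approx : ~ exists (A : nat -> R -> R) (h : R -> R -> R),
    [/\ conjectured_form M n A h, has_order M n A &
        is_loglinear_approx_solution M h].
  move=> [A [h [form [tau tauT /eqP Atau] sol]]]; apply: Atau.
  exact: (top_coef_zero (M := M) (h := h)).
split=> // -[A [h [form ord [ht [hv [hvv sol]]]]]]; apply: no_approx.
exists A, h; split=> //; exists ht, hv, hvv => t nu tT Snu.
by rewrite -loglinear_pdeE; exact: sol.
Qed.
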